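(* Let $C$ be a finite set of constants, $M$ an atomized semilattice model over $C$, and $Q$ a nonempty subset of $C$. Let $M^{|Q}$ be the subalgebra of $M$ generated by $Q$. Then $M^{|Q}$ is the model over $Q$ spawned by the restrictions to $Q$ of the atoms of $M$: for every set of atoms $A$ over $C$ that atomizes $M$, the set $\{\phi^{|Q}:\phi\in A,\ \mathbf{U}^c(\phi)\cap Q\ne\emptyset\}$ atomizes $M^{|Q}$. In particular, restricting the atoms of $M$ to $Q$ produces the same model $M^{|Q}$ for every atomization of $M$.
   Context: A semilattice is a nonempty set with a commutative, associative, idempotent binary operation $\odot$, ordered by $a\le b$ iff $a\odot b=b$. For a finite set $C$ of constants, $F_C(\emptyset)$ is the free semilattice on $C$; its elements (terms) $t$ are identified with their nonempty sets $\mathbf{C}(t)\subseteq C$ of component constants, with $\odot$ acting as union. A semilattice model over $C$ is a semilattice $M$ with a map $C\to M$ whose image generates $M$; it induces the natural homomorphism $\nu_M:F_C(\emptyset)\to M$. Two models over the same constants are regarded as equal if they satisfy the same inequalities between terms. $M^{|Q}$ is viewed as a model over $Q$. An atom $\phi$ over $C$ is determined by a nonempty subset $\mathbf{U}^c(\phi)\subseteq C$; for a term $t$, $\phi<t$ means $\mathbf{C}(t)\cap\mathbf{U}^c(\phi)\ne\emptyset$. A set $A$ of atoms over $C$ atomizes (spawns) $M$ if every $c\in C$ satisfies $\phi<c$ for some $\phi\in A$, and for all terms $t,s$ over $C$: $\nu_M(t)\le\nu_M(s)$ iff there is no $\phi\in A$ with $\phi<t$ and $\phi\not<s$ (and likewise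 with $Q$ in place of $C$). The restriction of $\phi$ to $Q$ is the atom $\phi^{|Q}$ over $Q$ with $\mathbf{U}^c(\phi^{|Q})=\mathbf{U}^c(\phi)\cap Q$; it does not exist if $\mathbf{U}^c(\phi)\cap Q=\emptyset$. *)

(* Defs.v *)
From HB Require Import structures.
From mathcomp Require Import all_boot all_order.
From mathcomp Require Import boolp classical_sets.
Set Implicit Arguments.
Unset Strict Implicit.
Unset Printing Implicit Defensive.

Import Order.LTheory.
Local Open Scope classical_set_scope.
Local Open Scope order_scope.

(* The free semilattice F_C(∅): a term is identified with its nonempty set of
   component constants. *)
Record term (C : finType) :=
  Term { consts : {set C}; consts_neq0 : consts != finset.set0 }.
HB.instance Definition _ C := [isSub for @consts C].
HB.instance Definition _ C := [Finite of term C by <:].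

Lemma const_subproof (C : finType) (c : C) : [set c]%SET != finset.set0.
Proof. by apply/set0Pn; exists c; rewrite finset.inE. Qed.

Definition const (C : finType) (c : C) : term C := Term (const_subproof c).

Lemma term_join_subproof (C : finType) (t s : term C) :
  consts t :|: consts s != finset.set0.
Proof.
by have /set0Pn[c ct] := consts_neq0 t; apply/set0Pn; exists c; rewrite inE ct.
Qed.

Definition term_join (C : finType) (t s : term C) : term C :=
  Term (term_join_subproof t s).

Section TermSemilattice.
Variable C : finType.
Implicit Types t s u : term C.

Let le t s := consts t \subset consts s.

Let le_refl : reflexive le. Proof. by move=> t; exact: subxx. Qed.

Let le_anti : antisymmetric le.
Proof. by move=> t s; rewrite -finset.eqEsubset => /eqP/val_inj. Qed.

Let le_trans : transitive le.
Proof. by move=> t s u; exact: fintype.subset_trans. Qed.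

HB.instance Definition _ :=
  Order.Le_isPOrder.Build Order.SetSubsetOrder.subset_display (term C)
    le_refl le_anti le_trans.

Lemma term_leUx t s u : (term_join t s <= u) = (t <= u) && (s <= u).
Proof. exact: finset.subUset. Qed.

HB.instance Definition _ := Order.POrder_isJoinSemilattice.Build
  Order.SetSubsetOrder.subset_display (term C) term_leUx.

End TermSemilattice.

Definition join_closed d (L : joinSemilatticeType d) (S : set L) : Prop :=
  forall x y, S x -> S y -> S (x `|` y).

Definition subalgebra_gen d (L : joinSemilatticeType d) (X : set L) : set L :=
  smallest (@join_closed d L) X.

(* Finitely generated semilattices are finite, so asking for a choice structure
   on the carrier is harmless.  The carrier is automatically nonempty as soon as
   C is. *)
Record model (d : Order.disp_t) (C : finType) := Model {
  carrier :> joinSemilatticeType d;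
  interp : C -> carrier;
  interp_gen : subalgebra_gen (range interp) = [set: carrier] }.

(* The value at t of the natural homomorphism F_C(∅) -> M.  There is no bottom
   element, so the iterated join is seeded with the value of some constant of
   t, which is harmless by idempotence. *)
Definition nu d (C : finType) (M : model d C) (t : term C) : M :=
  \big[Order.join/interp M (xchoose (set0Pn _ (consts_neq0 t)))]_(c in consts t)
    interp M c.

Lemma nu_leP d (C : finType) (M : model d C) (t : term C) (x : M) :
  reflect (forall c, c \in consts t -> interp M c <= x) (nu M t <= x).
Proof.
apply: (iffP idP) => [le_tx c ct|le_tx]; last first.
  rewrite /nu; elim/big_ind: _ => [|y z yx zx|c ct].
  - exact/le_tx/(xchooseP (set0Pn _ (consts_neq0 t))).
  - by rewrite leUx yx.
  - exact: le_tx.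
apply: le_trans le_tx; rewrite /nu -big_filter.
have : c \in [seq i <- index_enum C | i \in consts t].
  by rewrite mem_filter ct mem_index_enum.
elim: [seq _ <- _ | _] => // a r IHr; rewrite big_cons inE => /predU1P[->|/IHr].
  exact: leUl.
by move=> le_c; apply: le_trans le_c (leUr _ _).
Qed.

Lemma nu_const d (C : finType) (M : model d C) (c : C) :
  nu M (const c) = interp M c.
Proof.
apply/le_anti/andP; split.
  by apply/nu_leP => b; rewrite finset.inE => /eqP->.
by move/nu_leP: (lexx (nu M (const c))); apply; rewrite finset.inE.
Qed.

Lemma nu_join d (C : finType) (M : model d C) (t s : term C) :
  nu M (t `|` s) = nu M t `|` nu M s.
Proof.
apply/le_anti/andP; split.
  apply/nu_leP => c; rewrite finset.inE => /orP[ct|cs].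
    by apply: le_trans (leUl _ _); move: c ct; exact/nu_leP.
  by apply: le_trans (leUr _ _); move: c cs; exact/nu_leP.
have le_c c : c \in consts (t `|` s) -> interp M c <= nu M (t `|` s).
  by move: c; exact/nu_leP.
by rewrite leUx; apply/andP; split; apply/nu_leP => c cP;
  apply: le_c; rewrite finset.inE cP ?orbT.
Qed.

Definition model_eq d d' (C : finType) (M : model d C) (N : model d' C) : Prop :=
  forall t s : term C, nu M t <= nu M s <-> nu N t <= nu N s.

(* U^c(phi) is upper phi. *)
Record atom (C : finType) :=
  Atom { upper : {set C}; upper_neq0 : upper != finset.set0 }.
HB.instance Definition _ C := [isSub for @upper C].
HB.instance Definition _ C := [Finite of atom C by <:].

(* phi < t *)
Definition below (C : finType) (phi : atom C) (t : term C) : bool :=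
  consts t :&: upper phi != finset.set0.

Definition atomizes d (C : finType) (A : {set atom C}) (M : model d C) : Prop :=
  (forall c : C, exists2 phi, phi \in A & below phi (const c)) /\
  (forall t s : term C, nu M t <= nu M s <->
     ~ exists2 phi, phi \in A & below phi t && ~~ below phi s).

Definition atomized d (C : finType) (M : model d C) : Prop :=
  exists A : {set atom C}, atomizes A M.

Definition subconst (C : finType) (Q : {set C}) : finType := {c : C | c \in Q}.

(* None when U^c(phi) does not meet Q. *)
Definition restrict (C : finType) (Q : {set C}) (phi : atom C) :
    option (atom (subconst Q)) :=
  insub [set q : subconst Q | val q \in upper phi]%SET.

Definition restrict_atoms (C : finType) (Q : {set C}) (A : {set atom C}) :
    {set atom (subconst Q)} :=
  [set psi | [exists phi in A, restrict Q phi == Some psi]]%SET.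

Section Submodel.
Context d (C : finType) (M : model d C) (Q : {set C}).

Definition subcarrier_set : set M :=
  subalgebra_gen [set interp M c | c in [set` Q]].

Definition subcarrier : Type := set_type subcarrier_set.

HB.instance Definition _ := SubChoice.on subcarrier.
HB.instance Definition _ := [SubChoice_isSubPOrder of subcarrier by <: with d].

Lemma subcarrier_join_closed : join_closed subcarrier_set.
Proof.
by move=> x y Sx Sy S SP; apply: SP.1; [exact: Sx SP|exact: Sy SP].
Qed.

Lemma subjoin_subproof (x y : subcarrier) : val x `|` val y \in subcarrier_set.
Proof. by apply: mem_set; apply: subcarrier_join_closed; apply/set_mem/valP. Qed.

Definition subjoin (x y : subcarrier) : subcarrier :=
  Sub (val x `|` val y) (subjoin_subproof x y).

Lemma subjoin_leUx (x y z : subcarrier) :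
  (subjoin x y <= z) = (x <= z) && (y <= z).
Proof. by rewrite -!Order.le_val SubK Order.leUx. Qed.

HB.instance Definition _ :=
  Order.POrder_isJoinSemilattice.Build d subcarrier subjoin_leUx.

Lemma subinterp_subproof (q : subconst Q) : interp M (val q) \in subcarrier_set.
Proof. by apply/mem_set => S [_]; apply; exists (val q) => //=; exact: valP. Qed.

Definition subinterp (q : subconst Q) : subcarrier :=
  Sub (interp M (val q)) (subinterp_subproof q).

Lemma subinterp_gen : subalgebra_gen (range subinterp) = [set: subcarrier].
Proof.
apply/seteqP; split=> // -[x xS] _ T [cT sT] /=.
pose T' := [set y : M | exists2 z, T z & val z = y].
have : T' x.
  apply: (set_mem xS); split=> [_ _ [y Ty <-] [z Tz <-]|_ [c cQ <-]].
    by exists (subjoin y z); [exact: cT|].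
  by exists (subinterp (exist _ c cQ)); [apply: sT; exists (exist _ c cQ)|].
by move=> [z Tz zx]; rewrite (_ : exist _ x xS = z) //; apply: val_inj.
Qed.

(* M^{|Q} as a model over Q. *)
Definition submodel : model d (subconst Q) := Model subinterp_gen.

End Submodel.

(* Main.v *)
(* A term over Q is also a term over C.  The inclusion of the submodel in M
   preserves the value of terms over Q, and an atom is below a term over Q iff
   its restriction exists and is below that term.  So discriminating terms over
   Q by the atoms of M or by their restrictions is the same thing. *)
Require Import Defs.
From mathcomp Require Import all_boot all_order.

Import Order.LTheory.
Local Open Scope order_scope.

Section Restriction.
Context {C : finType} {Q : {set C}}.
Implicit Types (t s : term (subconst Q)) (phi : atom C).
Implicit Type psi : atom (subconst Q).

Lemma lift_term_subproof t : [set val q | q in consts t] != set0.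
Proof.
by have /set0Pn[q qt] := consts_neq0 t; apply/set0Pn; exists (val q); exact: imset_f.
Qed.

Definition lift_term t : term C := Term (lift_term_subproof t).

(** All constants of [lift_term t] lie in [Q], so they meet [upper phi] exactly where they meet its
    trace on [Q]. *)
Lemma below_restrict phi psi t :
  restrict Q phi = Some psi -> below psi t = below phi (lift_term t).
Proof.
rewrite /restrict; case: insubP => // u _ def_u [<-].
have {}def_u : upper u = [set q | val q \in upper phi] := def_u.
rewrite /below def_u; apply/set0Pn/set0Pn => -[q].
  rewrite !inE => /andP[qt qphi]; exists (val q).
  by rewrite inE qphi andbT; exact: imset_f.
by rewrite inE => /andP[/imsetP[r rt ->] rphi]; exists r; rewrite !inE rt.
Qed.

(** A constant witnessing that [phi] is below a term over [Q] lies in [Q], so [upper phi] meets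
    [Q]. *)
Lemma below_lift_restrict phi t :
  below phi (lift_term t) -> exists psi, restrict Q phi = Some psi.
Proof.
case/set0Pn=> c; rewrite inE => /andP[/imsetP[q _ ->] qphi].
rewrite /restrict; case: insubP => [psi _ _|/negP[]]; first by exists psi.
by apply/set0Pn; exists q; rewrite inE.
Qed.

Lemma mem_restrict_atoms (A : {set atom C}) psi :
  reflect (exists2 phi, phi \in A & restrict Q phi = Some psi)
          (psi \in restrict_atoms Q A).
Proof.
rewrite inE; apply: (iffP exists_inP) => -[phi phiA].
  by move/eqP; exists phi.
by move=> def_psi; exists phi => //; apply/eqP.
Qed.

(** Atoms without a restriction are below no term over [Q], so dropping them loses no
    discrimination. *)
Lemma discriminate_restrict (A : {set atom C}) t s :
  (exists2 psi, psi \in restrict_atoms Q A & below psi t && ~~ below psi s) <->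
  (exists2 phi, phi \in A &
     below phi (lift_term t) && ~~ below phi (lift_term s)).
Proof.
split=> [[psi /mem_restrict_atoms[phi phiA def_psi]]|[phi phiA]].
  by rewrite !(below_restrict _ _ _ def_psi); exists phi.
move=> /andP[phi_t phi_s]; have [psi def_psi] := below_lift_restrict _ _ phi_t.
exists psi; first by apply/mem_restrict_atoms; exists phi.
by rewrite !(below_restrict _ _ _ def_psi) phi_t.
Qed.

Lemma lift_const (q : subconst Q) : lift_term (const q) = const (val q).
Proof. by apply: val_inj; exact: imset_set1. Qed.

End Restriction.

Section Submodel.
Context {d : Order.disp_t} {C : finType} (M : model d C) {Q : {set C}}.
Implicit Types t s : term (subconst Q).

(** Both sides are least upper bounds of the same values, but the seeds of the two joins are chosen
    independently; hence two inequalities instead of a termwise match. *)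
Lemma val_nu_submodel t :
  val (nu (submodel M Q) t : subcarrier M Q) = nu M (lift_term t).
Proof.
have lift_le q : q \in consts t -> interp M (val q) <= nu M (lift_term t).
  by move=> qt; have /nu_leP := lexx (nu M (lift_term t)); apply; exact: imset_f.
apply/le_anti/andP; split.
  rewrite /nu; elim/big_ind: _ => [|x y x_le y_le|q qt]; last exact: lift_le.
    (* The seed is the value of a constant of [t], so it obeys the same bound. *)
    exact/lift_le/(xchooseP (set0Pn _ (consts_neq0 t))).
  by rewrite [val _](_ : _ = val (x : subcarrier M Q) `|` val (y : subcarrier M Q))
    // leUx x_le.
apply/nu_leP => c /imsetP[q qt ->].
(* The submodel carries the order of [M], so an upper bound in it is one in [M]. *)
by have /nu_leP := lexx (nu (submodel M Q) t); exact.
Qed.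

Lemma nu_submodel_le t s :
  (nu (submodel M Q) t <= nu (submodel M Q) s) =
  (nu M (lift_term t) <= nu M (lift_term s)).
Proof. by rewrite -!val_nu_submodel. Qed.

Lemma atomizes_submodel (A : {set atom C}) :
  atomizes A M -> atomizes (restrict_atoms Q A) (submodel M Q).
Proof.
case=> A_const A_le; split=> [q|t s]; last first.
  by rewrite nu_submodel_le A_le discriminate_restrict.
have [phi phiA] := A_const (val q); rewrite -lift_const => phi_q.
have [psi def_psi] := below_lift_restrict _ _ phi_q.
exists psi; last by rewrite (below_restrict _ _ _ def_psi).
by apply/mem_restrict_atoms; exists phi.
Qed.

End Submodel.

Lemma atomizes_model_eq (d d' : Order.disp_t) (C : finType) (A : {set atom C})
    (M : model d C) (N : model d' C) :
  atomizes A M -> atomizes A N -> model_eq M N.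
Proof. by move=> [_ A_M] [_ A_N] t s; rewrite A_M A_N. Qed.

Theorem theorem22 (d : Order.disp_t) (C : finType) (M : model d C)
    (Q : {set C}) (hM : atomized M) (hQ : Q != set0) :
  (forall A : {set atom C}, atomizes A M ->
     atomizes (restrict_atoms Q A) (submodel M Q)) /\
  (forall A : {set atom C}, atomizes A M ->
     forall (d' : Order.disp_t) (N : model d' (subconst Q)),
       atomizes (restrict_atoms Q A) N -> model_eq N (submodel M Q)).
Proof.
split=> [A|A A_M d' N A_N]; first exact: atomizes_submodel.
(* [N] and the submodel are spawned by the same atoms, and the submodel does not depend on [A]. *)
by apply: atomizes_model_eq A_N _; exact: atomizes_submodel.
Qed.
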